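(* Let $p\ge 1$ and fix a probability space. Then the norms $\|\cdot\|_{\psi_p}$ and $\tau_{\varphi_p}(\cdot)$ are equivalent on the space $L^0_{\psi_p}$; that is, there exist constants $c,C>0$ such that $$c\,\|X\|_{\psi_p}\le \tau_{\varphi_p}(X)\le C\,\|X\|_{\psi_p}\qquad\text{for all } X\in L^0_{\psi_p}.$$
   Context: All random variables are real-valued and defined on a fixed probability space; random variables that are equal almost surely are identified. For $p\ge 1$ the Luxemburg norm of a random variable $X$ is $$\|X\|_{\psi_p}:=\inf\{K>0:\ \mathbb{E}\exp(|X/K|^p)\le 2\}\qquad(\inf\emptyset=\infty).$$ The space $L_{\psi_p}$ consists of all $X$ with $\|X\|_{\psi_p}<\infty$, and $L^0_{\psi_p}:=\{X\in L_{\psi_p}:\ \mathbb{E}X=0\}$. For $r\in[1,\infty)$ define $\varphi_r:\mathbb{R}\to[0,\infty)$ by $\varphi_r(x)=\frac{x^2}{2}$ if $|x|\le 1$ and $\varphi_r(x)=\frac1r|x|^r-\frac1r+\frac12$ if $|x|>1$. Define $\varphi_\infty:\mathbb{R}\to[0,\infty]$ by $\varphi_\infty(x)=\frac{x^2}{2}$ if $|x|\le 1$ and $\varphi_\infty(x)=\infty$ if $|x|>1$. For $p\ge 1$ let $q=p/(p-1)$ if $p>1$ and $q=\infty$ if $p=1$, and define $$\tau_{\varphi_p}(X):=\inf\{K>0:\ \mathbb{E}\exp(tX)\le\exp(\varphi_q(Kt))\ \text{ for all } t\in\mathbb{R}\},$$ with the convention $\exp(\infty)=\infty$. *)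

(* Defs.v *)
From HB Require Import structures.
From mathcomp Require Export all_boot all_order all_algebra.
From mathcomp Require Export all_classical all_reals all_analysis.
Export Order.TTheory GRing.Theory Num.Theory.
Export numFieldNormedType.Exports.

Set Implicit Arguments.
Unset Strict Implicit.
Unset Printing Implicit Defensive.

Local Open Scope classical_set_scope.
Local Open Scope ring_scope.
Local Open Scope ereal_scope.

Section orlicz.
Context d (T : measurableType d) (R : realType) (P : probability T R).

(* The inner expectation is the extended-real integral of a nonnegative
   function, so it is [+oo] when the exponential is not integrable, and
   [ereal_inf set0 = +oo]. *)
Definition psi_norm (p : R) (X : T -> R) : \bar R :=
  ereal_inf [set K%:E | K in
    [set K : R | (0 < K)%R /\
       'E_P[fun w => expR (`|X w / K| `^ p)%R] <= 2%:E]].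

(* Elements are representatives: a.s. equal random variables are not
   identified. *)
Definition Lpsi (p : R) : set {RV P >-> R} :=
  [set X | psi_norm p X < +oo].

Definition Lpsi0 (p : R) : set {RV P >-> R} :=
  Lpsi p `&` [set X | 'E_P[X] = 0].

(* Meaningful for [1 <= r]; the value at [r = -oo] is junk. *)
Definition varphi (r : \bar R) (x : R) : \bar R :=
  if (`|x| <= 1)%R then (x ^+ 2 / 2)%R%:E
  else match r with
       | s%:E => (s^-1 * `|x| `^ s - s^-1 + 2^-1)%R%:E
       | _ => +oo
       end.

(* [hoelder_conjugate p%:E] is [p / (p - 1)] if [1 < p] and [+oo] if
   [p = 1]; ['M_P X t] is the expectation of [exp (t X)]. *)
Definition tau_varphi (p : R) (X : T -> R) : \bar R :=
  ereal_inf [set K%:E | K in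
    [set K : R | (0 < K)%R /\
       forall t : R,
         'M_P X t <= expeR (varphi (hoelder_conjugate p%:E) (K * t)%R)]].

End orlicz.

(* Main.v *)
Require Import Defs.
From mathcomp Require Import measurable_realfun ring lra.

(** Both norms are infima of sets of admissible constants [K], so it is enough
    to show that if [K] is admissible for one norm, then a fixed multiple of
    [K] is admissible for the other.  The multiples do not depend on [p].

    From the Luxemburg norm to [tau_varphi].  Let [E exp (|X / K| ^ p) <= 2],
    let [q] be the conjugate exponent and write [u = t * K].  For small [u],
    Taylor expansion to second order gives a bound [1 + C * u ^ 2] on
    [E exp (t * X)]: the linear term vanishes because [X] is centered
    ([mmt_le_quadratic]).  For arbitrary [u] and [p > 1], Young's inequality
    gives [E exp (t * X) <= 2 * exp (|u| ^ q / q)] ([mmt_le_conjugate]).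
    Replacing [K] by [exp 6 * K] makes [varphi] large enough to dominate
    whichever bound is in force ([mmt_le_expR_varphi]).  For [p = 1] the Taylor
    regime suffices, as [varphi] is infinite elsewhere.

    From [tau_varphi] to the Luxemburg norm.  Suppose that the moment
    generating function of [X / K] is at most [exp (varphi_q t)].  The Legendre
    duality between [|.| ^ q] and [|.| ^ p] can be realised, up to constants,
    by integer slopes only: for [y >= 0],

      [exp ((y / 4) ^ p) <= e + \sum_n exp (n * y - 2 * n ^ q)],

    since a single well chosen [n] already works ([expR_powR_le_nat]).
    Integrating this at [y = |X / K|] term by term turns the hypothesis at the
    points [n] and [- n] into a convergent series, so that
    [E exp ((|X / K| / 4) ^ p) <= 5 * e] ([integral_expR_powR_le]); this avoids
    the usual detour through tail probabilities.  Finally [5 * e] is brought down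
    to 2 by dividing [X] further, using the convexity of [exp]
    ([psi_norm_le]). *)

Set Implicit Arguments.
Unset Strict Implicit.

Local Open Scope classical_set_scope.
Local Open Scope ring_scope.

(** * Inequalities for the exponential function *)

Lemma expR1_ge2 (R : realType) : 2 <= expR 1 :> R.
Proof. by have := @expR_ge1Dx R 1; lra. Qed.

Lemma expR_le_quadratic (R : realType) (x : R) :
  expR x <= 1 + x + x ^+ 2 * expR `|x|.
Proof.
have E0 := expR_gt0 x.
have h1 : expR x - 1 <= x * expR x.
  have : (1 - x) * expR x <= expR (- x) * expR x.
    by rewrite ler_pM2r//; exact: expR_ge1Dx.
  by rewrite -expRD addNr expR0; lra.
have h2 := expR_ge1Dx x.
have [x0|x0] := leP 0 x.
  rewrite ger0_norm//; nra.
rewrite ltr0_norm//.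
have : 1 <= expR (- x) by have := expR_ge1Dx (- x); lra.
nra.
Qed.

Lemma ler_1DpowR (R : realType) (p v : R) : 1 <= p -> 0 <= v -> v <= 1 + v `^ p.
Proof.
move=> p1 v0; have [v1|v1] := leP v 1.
  by rewrite (le_trans v1)// lerDl powR_ge0.
rewrite -[leLHS]powRr1// (@le_trans _ _ (v `^ p))//; last by lra.
by rewrite ler_powR// ltW.
Qed.

(** The second-order Taylor remainder of [expR] at [t * y] is at most
    [t ^ 2 * y ^ 2 * expR (|y| / 2)]; one factor [expR (|y| / 2)] pays for
    [y ^ 2], and then [|y| <= 1 + |y| ^ p] brings in the [p]-th power. *)
Lemma expRM_le_powR (R : realType) (p t y : R) : 1 <= p -> `|t| <= 2^-1 ->
  expR (t * y) <= 1 + t * y + (16 * expR 1 * t ^+ 2) * expR (`|y| `^ p).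
Proof.
move=> p1 t2; apply: (le_trans (expR_le_quadratic _)); rewrite lerD2l.
have y2 : y ^+ 2 <= 16 * expR (`|y| / 2).
  have h : `|y| / 4 <= expR (`|y| / 4) by have := expR_ge1Dx (`|y| / 4); lra.
  have -> : `|y| / 2 = `|y| / 4 + `|y| / 4 by field.
  rewrite expRD -(real_normK (num_real y)).
  have := normr_ge0 y; nra.
have e2 : expR `|t * y| <= expR (`|y| / 2).
  by rewrite ler_expR normrM mulrC ler_wpM2l.
have e3 : expR (`|y| / 2) * expR (`|y| / 2) <= expR 1 * expR (`|y| `^ p).
  have -> : expR (`|y| / 2) * expR (`|y| / 2) = expR `|y|.
    by rewrite -expRD; congr expR; field.
  by rewrite -expRD ler_expR ler_1DpowR.
have -> : 16 * expR 1 * t ^+ 2 * expR (`|y| `^ p) =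
  t ^+ 2 * (16 * (expR 1 * expR (`|y| `^ p))) by ring.
rewrite exprMn -mulrA ler_wpM2l ?sqr_ge0//.
apply: (@le_trans _ _ (16 * expR (`|y| / 2) * expR (`|y| / 2))).
  by apply: ler_pM => //; exact: sqr_ge0.
by rewrite -mulrA ler_wpM2l.
Qed.

(** Convexity of [expR] between 0 and [a], proved from the tangent line at
    [a / M]. *)
Lemma expR_div_le (R : realType) (M a : R) : 1 <= M ->
  expR (a / M) <= (1 - M^-1) + M^-1 * expR a.
Proof.
move=> M1; have M0 : 0 <= M^-1 by rewrite invr_ge0; lra.
have M2 : M^-1 <= 1 by rewrite invf_le1; lra.
have tangent b : expR (a / M) * (1 + (b - a / M)) <= expR b.
  have -> : expR b = expR (a / M) * expR (b - a / M).
    by rewrite -expRD addrC subrK.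
  by rewrite ler_wpM2l ?expR_ge0// expR_ge1Dx.
have := tangent 0; have := tangent a; rewrite expR0.
set z := expR (a / M); set w := expR a => ta t0.
have ha : M^-1 * (z * (1 + (a - a / M))) <= M^-1 * w by rewrite ler_wpM2l.
have h0 : (1 - M^-1) * (z * (1 + (0 - a / M))) <= (1 - M^-1) * 1.
  by rewrite ler_wpM2l//; lra.
have : z = M^-1 * (z * (1 + (a - a / M))) +
           (1 - M^-1) * (z * (1 + (0 - a / M))) by ring.
lra.
Qed.

(** Controls exponential moments of [|X|] by the moment generating function of
    [X] at two opposite points. *)
Lemma expR_norm_le (R : realType) (c x : R) :
  expR (c * `|x|) <= expR (c * x) + expR (- c * x).
Proof.
have [x0|x0] := leP 0 x.
  by rewrite ger0_norm// lerDl expR_ge0.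
by rewrite ltr0_norm// mulrN -mulNr lerDr expR_ge0.
Qed.

Lemma ler_nat_powR (R : realType) (q : R) (n : nat) : 1 <= q ->
  n%:R <= n%:R `^ q.
Proof.
move=> q1; case: n => [|n]; first exact: powR_ge0.
by rewrite -[leLHS]powRr1// ler_powR// ler1n.
Qed.

Lemma expRN_nat_le (R : realType) (n : nat) : expR (- n%:R) <= (2 ^+ n)^-1 :> R.
Proof.
rewrite expRN lef_pV2 ?posrE ?expR_gt0 ?exprn_gt0//.
rewrite -[n%:R]mulr1 expRM_natl.
by rewrite lerXn2r ?nnegrE ?expR_ge0// expR1_ge2.
Qed.

(** * Bounds on [varphi] *)

(** For [|s| > 1], [varphi] is at least [1/2], which a quadratic function with
    the small coefficient [1 / (2 * expR 4)] does not exceed before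
    [|s| = expR 2]. *)
Lemma varphi_ge_quadratic (R : realType) (r : \bar R) (s : R) : (1 <= r)%E ->
  `|s| <= expR 2 -> ((s ^+ 2 / (2 * expR 4))%:E <= varphi r s)%E.
Proof.
move=> r1 s2; rewrite /varphi; have e4 : 1 <= expR 4 :> R.
  by have := @expR_ge1Dx R 4; lra.
case: ifPn => [s1|].
  rewrite lee_fin ler_wpM2l ?sqr_ge0// lef_pV2 ?posrE//; move: e4; lra.
rewrite -ltNge => s1; case: r r1 => [q| _|]//; last by rewrite leey.
rewrite !lee_fin => q1.
have : 1 <= `|s| `^ q by rewrite -[leLHS](powRr0 `|s|) ler_powR ?ltW//; lra.
move=> sq; apply: (@le_trans _ _ (2^-1)).
  rewrite ler_pdivrMr; last by nra.
  have -> : expR 4 = expR 2 * expR 2 :> R by rewrite -expRD; congr expR; lra.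
  have : `|s| * `|s| <= expR 2 * expR 2 by exact: ler_pM.
  by rewrite -expr2 real_normK ?num_real//; lra.
have q0 : 0 < q^-1 by rewrite invr_gt0; lra.
nra.
Qed.

(** Halving the argument divides [|s| ^ q] by at least 2, and the other half of
    [|s| ^ q / q], which is at least [expR (2 * q) / (2 * q)], pays for the
    constant terms. *)
Lemma varphi_ge_powR (R : realType) (q s : R) : 1 <= q -> expR 2 <= `|s| ->
  ((1 + (`|s| / 2) `^ q / q)%:E <= varphi q%:E s)%E.
Proof.
move=> q1 s2; rewrite /varphi.
have e2 : 1 < expR 2 :> R by have := @expR_ge1Dx R 2; lra.
rewrite ifF; last by apply/negbTE; rewrite -ltNge (lt_le_trans e2 s2).
rewrite lee_fin.
have q0 : 0 < q by lra.
have sq : 1 + 2 * q <= `|s| `^ q.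
  apply: (@le_trans _ _ (expR 2 `^ q)); last first.
    by rewrite ge0_ler_powR ?nnegrE ?expR_ge0//; lra.
  by rewrite -expRM mulrC; exact: expR_ge1Dx.
have h : (`|s| / 2) `^ q <= `|s| `^ q / 2.
  rewrite mulrC [leRHS]mulrC; apply: ge1r_powRZ => //.
  by apply/andP; split; lra.
have qi : 0 < q^-1 by rewrite invr_gt0.
have qq : q * q^-1 = 1 by rewrite divff// gt_eqF.
nra.
Qed.

Lemma varphi_nat_le (R : realType) (q : R) (n : nat) : 1 <= q ->
  (varphi q%:E n%:R <= (1 + n%:R `^ q)%:E)%E.
Proof.
move=> q1; rewrite /varphi normr_nat.
have a0 := powR_ge0 (n%:R) q.
case: ifPn => [n1|_]; rewrite lee_fin.
  have := ler0n R n; nra.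
have qi : 0 < q^-1 by rewrite invr_gt0; lra.
have : q^-1 <= 1 by rewrite invf_le1; lra.
nra.
Qed.

(** * Duality with integer slopes *)

Lemma hoelder_conjugate_gt1 (R : realType) (p : R) : 1 < p ->
  exists q : R, [/\ 1 < q, p^-1 + q^-1 = 1 &
                    hoelder_conjugate p%:E = q%:E].
Proof.
move=> p1; exists (p / (p - 1)); split.
- by rewrite ltr_pdivlMr; lra.
- by field; rewrite ?gt_eqF//=; lra.
- rewrite /hoelder_conjugate/= eqe gt_eqF; last by lra.
  by rewrite -EFinB inver subr_eq0 gt_eqF.
Qed.

(** With [z = y / 4], the slope to take is the integer part [n] of
    [z ^ (p - 1)].  Since [(p - 1) * (q - 1) = 1], this gives [n ^ q <= n * z],
    hence [n * y - 2 * n ^ q >= 2 * n * z], and [2 * n >= z ^ (p - 1)] as soon as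
    [z >= 1].  The summand [expR 1] covers [z < 1]. *)
Lemma expR_powR_le_nat (R : realType) (p q y : R) : 1 < p -> 1 < q ->
  p^-1 + q^-1 = 1 -> 0 <= y ->
  exists n : nat, expR ((y / 4) `^ p) <= expR 1 +
    expR (n%:R * y - 2 * n%:R `^ q).
Proof.
move=> p1 q1 pq y0; have [z1|z1] := ltP (y / 4) 1.
  exists 0; rewrite (@le_trans _ _ (expR 1))//; last first.
    by rewrite lerDl expR_ge0.
  rewrite ler_expR [leRHS](_ : _ = 1 `^ p); last by rewrite powR1.
  by rewrite ge0_ler_powR ?nnegrE//; lra.
set z := y / 4 in z1 *; have z0 : 0 <= z by lra.
exists (Num.trunc (z `^ (p - 1))); set n := Num.trunc _.
rewrite -[leLHS]add0r lerD ?expR_ge0// ler_expR.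
have a1 : 1 <= z `^ (p - 1) by rewrite -[leLHS](powRr0 z) ler_powR//; lra.
have /andP[na an] : n%:R <= z `^ (p - 1) < n.+1%:R by apply: truncn_itv; lra.
have n1 : 1 <= n%:R :> R by rewrite ler1n truncn_gt0.
have pqz : (p - 1) * (q - 1) = 1.
  have : p * q * (p^-1 + q^-1) = p * q by rewrite pq mulr1.
  rewrite mulrDr [p * q / p]mulrAC mulfV ?gt_eqF ?mulfK ?gt_eqF//; lra.
have nz : n%:R `^ (q - 1) <= z.
  rewrite -[leRHS](powRr1 z0) -[X in _ <= _ `^ X]pqz powRrM.
  by rewrite ge0_ler_powR ?nnegrE ?powR_ge0//; lra.
rewrite -(@mulr_powRB1 _ n%:R q)//; last by lra.
rewrite -(@mulr_powRB1 _ z p)//; last by lra.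
have -> : y = 4 * z by rewrite /z; field.
rewrite -natr1 in an.
nra.
Qed.

Local Open Scope ereal_scope.

(** * Measurability and integration of affine bounds *)

Lemma measurable_expR_powR (R : realType) d (T : measurableType d)
  (X : T -> R) (p K : R) : measurable_fun setT X ->
  measurable_fun setT (fun w => expR (`|X w / K| `^ p)%R).
Proof.
move=> mX; apply: measurableT_comp => //.
apply: (@measurableT_comp _ _ _ _ _ _ (fun x => powR x p)) => //.
apply: measurableT_comp => //.
exact: measurable_funM.
Qed.

Lemma measurable_expR_scale (R : realType) d (T : measurableType d)
  (X : T -> R) (t : R) : measurable_fun setT X ->
  measurable_fun setT (fun w => expR (t * X w)%R).
Proof.
move=> mX; apply: measurableT_comp => //.
exact: measurable_funM.
Qed.

Lemma mmt_gen_funE (R : realType) d (T : measurableType d)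
  (P : probability T R) (X : T -> R) (t : R) :
  'M_P X t = \int[P]_w (expR (t * X w)%R)%:E.
Proof.
rewrite /mmt_gen_fun unlock; apply: eq_integral => w _ /=.
by rewrite mulrC.
Qed.

Lemma integral_affine (R : realType) d (T : measurableType d)
  (P : probability T R) (a c : R) (G : T -> R) : (0 <= a)%R -> (0 <= c)%R ->
  measurable_fun setT G -> (forall w, 0 <= G w)%R ->
  \int[P]_w (a + c * G w)%R%:E = a%:E + c%:E * \int[P]_w (G w)%:E.
Proof.
move=> a0 c0 mG G0.
under eq_integral do rewrite EFinD EFinM.
have mGE : measurable_fun setT (fun w => (G w)%:E).
  exact/measurable_EFinP.
rewrite ge0_integralD//; last 2 first.
- by move=> w _; rewrite -EFinM lee_fin mulr_ge0.
- exact: measurable_funeM.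
rewrite integral_cst//= probability_setT mule1; congr (_ + _).
by rewrite ge0_integralZl// => w _; rewrite lee_fin.
Qed.

(** The integrability of [f] needed to integrate the pointwise bound is a
    consequence of that bound, as [f] is nonnegative. *)
Lemma integral_le_affine_centered (R : realType) d (T : measurableType d)
  (P : probability T R) (X f G : T -> R) (a b c : R) :
  measurable_fun setT f -> (forall w, 0 <= f w)%R ->
  P.-integrable setT (EFin \o X) -> \int[P]_w (X w)%:E = 0 ->
  P.-integrable setT (EFin \o G) ->
  (forall w, f w <= a + b * X w + c * G w)%R ->
  \int[P]_w (f w)%:E <= a%:E + c%:E * \int[P]_w (G w)%:E.
Proof.
move=> mf f0 iX X0 iG fle.
have ia : P.-integrable setT (EFin \o cst a).
  by apply: finite_measure_integrable_cst.
have ibX : P.-integrable setT (fun w => b%:E * (X w)%:E).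
  exact: integrableZl.
have icG : P.-integrable setT (fun w => c%:E * (G w)%:E).
  exact: integrableZl.
have iaX : P.-integrable setT (fun w => a%:E + b%:E * (X w)%:E).
  exact: integrableD.
have iS : P.-integrable setT
    (fun w => (a%:E + b%:E * (X w)%:E) + c%:E * (G w)%:E).
  exact: integrableD.
have fS w : (f w)%:E <= (a%:E + b%:E * (X w)%:E) + c%:E * (G w)%:E.
  by rewrite -!EFinM -!EFinD lee_fin.
have If : P.-integrable setT (EFin \o f).
  apply: le_integrable iS => //; first exact/measurable_EFinP.
  move=> w _ /=; rewrite (ger0_norm (f0 w)).
  by rewrite (le_trans (fS w))// lee_abs.
apply: (@le_trans _ _ (\int[P]_w
    ((a%:E + b%:E * (X w)%:E) + c%:E * (G w)%:E))).
  by apply: le_integral.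
rewrite integralD// integralD// integral_cst//= probability_setT mule1.
by rewrite integralZl// X0 mule0 adde0 integralZl.
Qed.

Lemma integrable_expR_powR (R : realType) d (T : measurableType d)
  (P : probability T R) (X : {RV P >-> R}) (p K M : R) :
  \int[P]_w (expR (`|X w / K| `^ p)%R)%:E <= M%:E ->
  P.-integrable setT (EFin \o (fun w => expR (`|X w / K| `^ p)%R)).
Proof.
move=> EM; have mG := measurable_expR_powR p K (measurable_funPT X).
apply/integrableP; split; first exact/measurable_EFinP.
under eq_integral => w _ do rewrite /= ger0_norm ?expR_ge0//.
exact: le_lt_trans EM (ltry _).
Qed.

Lemma integrable_of_expR_powR (R : realType) d (T : measurableType d)
  (P : probability T R) (X : {RV P >-> R}) (p K M : R) :
  (1 <= p)%R -> (0 < K)%R ->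
  \int[P]_w (expR (`|X w / K| `^ p)%R)%:E <= M%:E ->
  P.-integrable setT (EFin \o X).
Proof.
move=> p1 K0 EM; have iG := integrable_expR_powR EM.
have iKG : P.-integrable setT
    (fun w => K%:E * (expR (`|X w / K| `^ p)%R)%:E) by exact: integrableZl.
apply: le_integrable iKG => //; first exact/measurable_EFinP.
move=> w _ /=; rewrite lee_fin [leRHS]ger0_norm; last
  by rewrite mulr_ge0 ?expR_ge0// ltW.
have -> : (`|X w| = K * `|X w / K|)%R.
  by rewrite normrM normfV (gtr0_norm K0); field; rewrite gt_eqF.
rewrite ler_pM2l// (le_trans (ler_1DpowR p1 (normr_ge0 _)))//.
exact: expR_ge1Dx.
Qed.

(** * From the Luxemburg norm to the moment generating function *)

(** Taylor regime.  The linear term of the pointwise bound has mean zero, which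
    is the only use made of the centering of [X]. *)
Lemma mmt_le_quadratic (R : realType) d (T : measurableType d)
  (P : probability T R) (X : {RV P >-> R}) (p K t : R) :
  (1 <= p)%R -> (0 < K)%R -> 'E_P[X] = 0 ->
  \int[P]_w (expR (`|X w / K| `^ p)%R)%:E <= 2%:E ->
  (`|t * K| <= 2^-1)%R ->
  'M_P X t <= (1 + 32 * expR 1 * (t * K) ^+ 2)%R%:E.
Proof.
move=> p1 K0 X0 E2 tK; rewrite mmt_gen_funE; rewrite unlock in X0.
have mE := measurable_expR_scale t (measurable_funPT X).
have iG := integrable_expR_powR E2.
have iX := integrable_of_expR_powR p1 K0 E2.
set c := (16 * expR 1 * (t * K) ^+ 2)%R.
have c0 : (0 <= c)%R by rewrite mulr_ge0 ?sqr_ge0// mulr_ge0// expR_ge0.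
have := @integral_le_affine_centered _ _ _ P X _ _ 1%R t c mE
  (fun w => expR_ge0 _) iX X0 iG.
move=> /(_ _)/le_trans; apply.
  move=> w; have -> : (t * X w = t * K * (X w / K))%R.
    by field; rewrite gt_eqF.
  exact: expRM_le_powR.
apply: (@le_trans _ _ (1%:E + c%:E * 2%:E)).
  by rewrite leeD2l// lee_wpmul2l// lee_fin.
by rewrite -EFinM -EFinD lee_fin /c; lra.
Qed.

(** Young regime: [t * X <= |t * K| ^ q / q + |X / K| ^ p / p] pointwise; the
    summand 1 absorbs the factor 2, since [2 <= expR 1]. *)
Lemma mmt_le_conjugate (R : realType) d (T : measurableType d)
  (P : probability T R) (X : {RV P >-> R}) (p q K t : R) :
  (1 < p)%R -> (1 < q)%R -> (p^-1 + q^-1 = 1)%R -> (0 < K)%R ->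
  \int[P]_w (expR (`|X w / K| `^ p)%R)%:E <= 2%:E ->
  'M_P X t <= (expR (1 + `|t * K| `^ q / q)%R)%:E.
Proof.
move=> p1 q1 pq K0 E2; rewrite mmt_gen_funE.
have mX : measurable_fun setT X by exact: measurable_funPT.
have mE := measurable_expR_scale t mX.
have mG := measurable_expR_powR p K mX.
have q0 : (0 < q)%R by lra.
have p0 : (0 < p)%R by lra.
set A := (`|t * K| `^ q / q)%R.
apply: (@le_trans _ _ (\int[P]_w (0 + expR A * expR (`|X w / K| `^ p))%R%:E)).
  apply: ge0_le_integral => //.
  - exact/measurable_EFinP.
  - by apply/measurable_EFinP; apply: measurable_funD => //;
      exact: measurable_funM.
  - move=> w _; rewrite lee_fin add0r -expRD ler_expR.
    have -> : (t * X w = t * K * (X w / K))%R by field; rewrite gt_eqF.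
    apply: (le_trans (ler_norm _)); rewrite (normrM (t * K)%R).
    apply: (le_trans (conjugate_powR _ _ q0 p0 _)) => //.
      by rewrite addrC.
    by rewrite lerD2l ler_pdivrMr// ler_peMr ?powR_ge0// ltW.
rewrite integral_affine ?expR_ge0// add0e.
apply: (@le_trans _ _ ((expR A)%:E * (expR 1)%:E)).
  rewrite lee_wpmul2l ?lee_fin ?expR_ge0//.
  by rewrite (le_trans E2)// lee_fin expR1_ge2.
by rewrite -EFinM -expRD lee_fin ler_expR addrC.
Qed.

(** The two regimes are glued at [|s| = expR 2], where [s = expR 6 * K * t], and
    not at [|s| = 1], the breakpoint of [varphi]: just above that breakpoint
    [varphi] is close to [1/2], too small to absorb the factor 2 of the Young
    regime, whereas the quadratic bound still holds there because [t * K] is a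
    small multiple of [s]. *)
Lemma mmt_le_expR_varphi (R : realType) d (T : measurableType d)
  (P : probability T R) (X : {RV P >-> R}) (p K : R) :
  (1 <= p)%R -> (0 < K)%R -> 'E_P[X] = 0 ->
  \int[P]_w (expR (`|X w / K| `^ p)%R)%:E <= 2%:E ->
  forall t, 'M_P X t <=
    expeR (varphi (hoelder_conjugate p%:E) (expR 6 * K * t)%R).
Proof.
move=> p1 K0 X0 E2 t.
set s := (expR 6 * K * t)%R.
have su : s = (expR 6 * (t * K))%R by rewrite /s; ring.
have us : (`|s| = expR 6 * `|t * K|)%R.
  by rewrite su (normrM (expR 6)) (ger0_norm (expR_ge0 6)).
have e1 : (2 <= expR 1 :> R)%R by exact: expR1_ge2.
have e_nat n : expR n%:R = (expR 1 ^+ n)%R :> R by rewrite -expRM_natl mulr1.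
have [s2|s2] := leP `|s|%R (expR 2).
  have u2 : (`|t * K| <= 2^-1)%R.
    move: s2; rewrite us.
    have -> : expR 6 = (expR 2 * expR 4)%R :> R.
      by rewrite -expRD; congr expR; lra.
    rewrite -mulrA -[leRHS]mulr1 ler_pM2l ?expR_gt0// => h.
    have := @expR_ge1Dx R 4; have := normr_ge0 (t * K)%R; nra.
  apply: (le_trans (mmt_le_quadratic p1 K0 X0 E2 u2)).
  apply: (@le_trans _ _ (expR (s ^+ 2 / (2 * expR 4)))%:E); last first.
    rewrite -[leLHS]/(expeR (s ^+ 2 / (2 * expR 4))%:E) lee_expeR.
    by apply: varphi_ge_quadratic => //; apply: hoelder_conj_ge1; rewrite lee_fin.
  rewrite lee_fin; apply: le_trans (expR_ge1Dx _); rewrite lerD2l.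
  have -> : (s ^+ 2 / (2 * expR 4) = expR 1 ^+ 8 / 2 * (t * K) ^+ 2)%R.
    by rewrite su !e_nat; field; rewrite ?gt_eqF ?expR_gt0.
  have e8 : (64 * expR 1 <= expR 1 ^+ 8 :> R)%R.
    rewrite exprSr ler_pM2r ?expR_gt0//.
    have : (2 ^+ 7 <= expR 1 ^+ 7 :> R)%R by rewrite lerXn2r ?nnegrE ?expR_ge0.
    lra.
  have := sqr_ge0 (t * K)%R; nra.
have [<-|p1'] := eqVneq 1%R p.
  (* Here the conjugate exponent is [+oo], and so is [varphi] beyond 1. *)
  rewrite hoelder_conjugate1 /varphi ifF; first by rewrite leey.
  apply/negbTE; rewrite -ltNge (lt_trans _ s2)//.
  by have := @expR_ge1Dx R 2; lra.
have pgt1 : (1 < p)%R by rewrite lt_neqAle p1'.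
have [q [qgt1 pq ->]] := hoelder_conjugate_gt1 pgt1.
apply: (le_trans (mmt_le_conjugate t pgt1 qgt1 pq K0 E2)).
rewrite -[leLHS]/(expeR (1 + `|t * K| `^ q / q)%:E) lee_expeR.
apply: le_trans (varphi_ge_powR (ltW qgt1) (ltW s2)).
rewrite lee_fin lerD2l ler_pM2r ?invr_gt0//; last by lra.
rewrite ge0_ler_powR ?nnegrE//; first by lra.
by rewrite us; have := @expR_ge1Dx R 6; have := normr_ge0 (t * K)%R; nra.
Qed.

(** * From the moment generating function to the Luxemburg norm *)

(** An exponential moment bounded by any [M], not only by 2, controls the
    Luxemburg norm: dividing [X] by [M] more divides [|X / K| ^ p] by at least
    [M], and then convexity gives a moment at most [(1 - 1 / M) + 1]. *)
Lemma psi_norm_le (R : realType) d (T : measurableType d)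
  (P : probability T R) (X : {RV P >-> R}) (p K M : R) :
  (1 <= p)%R -> (0 < K)%R -> (1 <= M)%R ->
  \int[P]_w (expR (`|X w / K| `^ p)%R)%:E <= M%:E ->
  psi_norm P p X <= (M * K)%:E.
Proof.
move=> p1 K0 M1 EM; apply: ereal_inf_lbound => /=; exists (M * K)%R => //.
have M0 : (0 < M)%R by lra.
split; first by rewrite mulr_gt0.
have mX : measurable_fun setT X by exact: measurable_funPT.
have mG := measurable_expR_powR p K mX.
have Mi0 : (0 <= M^-1)%R by rewrite invr_ge0 ltW.
have Mi1 : (0 <= 1 - M^-1)%R by rewrite subr_ge0 invf_le1.
rewrite unlock; apply: (@le_trans _ _
  (\int[P]_w ((1 - M^-1) + M^-1 * expR (`|X w / K| `^ p))%R%:E)).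
  apply: ge0_le_integral => //.
  - by apply/measurable_EFinP; exact: measurable_expR_powR.
  - by apply/measurable_EFinP; apply: measurable_funD => //;
      exact: measurable_funM.
  move=> w _; rewrite lee_fin; apply: le_trans (expR_div_le _ M1).
  rewrite ler_expR.
  have -> : (`|X w / (M * K)| = M^-1 * `|X w / K|)%R.
    rewrite !normrM !normfV normrM (gtr0_norm M0); field.
    by rewrite normr_eq0 !gt_eqF.
  rewrite [leRHS]mulrC; apply: ge1r_powRZ => //.
  by rewrite invr_gt0 M0 invf_le1.
rewrite integral_affine//.
apply: (@le_trans _ _ ((1 - M^-1)%:E + M^-1%:E * M%:E)).
  by rewrite leeD2l// lee_wpmul2l.
by rewrite -EFinM -EFinD lee_fin mulVf ?gt_eqF//; lra.
Qed.

(** For [p > 1], the [n]-th term [f n] of the series has integral at most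
    [2 * expR (- 2 * n ^ q) * expR (1 + n ^ q) <= 2 * e / 2 ^ n]; the geometric
    series contributes [4 * e], and the constant of the pointwise bound [e].
    For [p = 1], where only [|t| <= 1 / K] is informative, the two points
    [t = 1 / K] and [t = - 1 / K] suffice. *)
Lemma integral_expR_powR_le (R : realType) d (T : measurableType d)
  (P : probability T R) (X : {RV P >-> R}) (p K : R) :
  (1 <= p)%R -> (0 < K)%R ->
  (forall t, 'M_P X t <=
    expeR (varphi (hoelder_conjugate p%:E) (K * t)%R)) ->
  \int[P]_w (expR (`|X w / (4 * K)| `^ p)%R)%:E <= (5 * expR 1)%:E.
Proof.
move=> p1 K0 MX.
have mX : measurable_fun setT X by exact: measurable_funPT.
have mE t := measurable_expR_scale t mX.
have mG := measurable_expR_powR p (4 * K) mX.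
have mEE t : measurable_fun setT (fun w => (expR (t * X w)%R)%:E).
  exact/measurable_EFinP.
have mGE : measurable_fun setT (fun w => (expR (`|X w / (4 * K)| `^ p)%R)%:E).
  exact/measurable_EFinP.
have e1 : (2 <= expR 1 :> R)%R by exact: expR1_ge2.
have X4 w : (`|X w / (4 * K)| = `|X w| / K / 4)%R.
  rewrite normrM normfV (gtr0_norm (x:=(4 * K)%R)) ?mulr_gt0//; field.
  by rewrite gt_eqF.
have y0 w : (0 <= `|X w| / K)%R by rewrite divr_ge0// ltW.
have [p1e|p1'] := eqVneq 1%R p.
  have MX1 t : (`|K * t| <= 1)%R ->
      \int[P]_w (expR (t * X w)%R)%:E <= (expR 1)%:E.
    move=> t1; rewrite -mmt_gen_funE (le_trans (MX t))//.
    rewrite /varphi t1/= lee_fin ler_expR.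
    rewrite -real_normK ?num_real//; have := normr_ge0 (K * t)%R; nra.
  apply: (@le_trans _ _ (\int[P]_w
      ((expR (K^-1 * X w)%R)%:E + (expR (- K^-1 * X w)%R)%:E))).
    apply: ge0_le_integral => //; first exact: emeasurable_funD.
    move=> w _; rewrite -EFinD lee_fin.
    apply: le_trans (expR_norm_le _ _).
    rewrite -p1e powRr1// ler_expR X4 mulrC; have := y0 w; lra.
  rewrite ge0_integralD//.
  apply: (@le_trans _ _ ((expR 1)%:E + (expR 1)%:E)).
    apply: leeD; apply: MX1; rewrite ?mulrN ?normrN mulfV ?gt_eqF// normr1//.
  by rewrite -EFinD lee_fin; lra.
have pgt1 : (1 < p)%R by rewrite lt_neqAle p1'.
have [q [qgt1 pq qE]] := hoelder_conjugate_gt1 pgt1.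
pose f n w := (expR (- 2 * n%:R `^ q) *
  (expR (n%:R / K * X w) + expR (- (n%:R / K) * X w)))%R.
have f0 n w : (0 <= f n w)%R by rewrite mulr_ge0 ?addr_ge0 ?expR_ge0.
have mf n : measurable_fun setT (fun w => (f n w)%:E).
  apply/measurable_EFinP; apply: measurable_funM => //.
  exact: measurable_funD.
have MXn n t : (`|K * t| = n%:R)%R ->
    \int[P]_w (expR (t * X w)%R)%:E <= (expR (1 + n%:R `^ q))%:E.
  move=> tn; rewrite -mmt_gen_funE (le_trans (MX t))//.
  rewrite -[leRHS]/(expeR (1 + n%:R `^ q)%:E) lee_expeR qE.
  apply: le_trans (varphi_nat_le n (ltW qgt1)).
  by rewrite /varphi tn normr_nat -(real_normK (num_real (K * t)%R)) tn.
have If n : \int[P]_w (f n w)%:E <= (4 * expR 1 / (2 ^ (n + 1))%:R)%:E.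
  under eq_integral => w _ do rewrite EFinM EFinD.
  rewrite ge0_integralZl//; last 2 first.
  - exact: emeasurable_funD.
  - by move=> w _; rewrite -EFinD lee_fin addr_ge0 ?expR_ge0.
  rewrite ge0_integralD//.
  apply: (@le_trans _ _ ((expR (- 2 * n%:R `^ q))%:E *
      ((expR (1 + n%:R `^ q))%:E + (expR (1 + n%:R `^ q))%:E))).
    rewrite lee_wpmul2l ?lee_fin ?expR_ge0//.
    apply: leeD; apply: MXn; rewrite ?mulrN ?normrN mulrC divfK ?gt_eqF//;
      exact: normr_nat.
  rewrite -EFinD -EFinM lee_fin mulrDr -expRD.
  have -> : (- 2 * n%:R `^ q + (1 + n%:R `^ q) = 1 + - n%:R `^ q :> R)%R by ring.
  rewrite expRD natrX addn1 exprS invfM.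
  have : (expR (- n%:R `^ q) <= (2 ^+ n)^-1 :> R)%R.
    apply: le_trans (expRN_nat_le _ n); rewrite ler_expR lerN2.
    exact/ler_nat_powR/ltW.
  nra.
have mS : measurable_fun setT (fun w => \sum_(n <oo) (f n w)%:E).
  apply: (ge0_emeasurable_sum (h := fun n w => (f n w)%:E) (P := xpredT)) => //.
  by move=> k w _ _; rewrite lee_fin.
apply: (@le_trans _ _ (\int[P]_w ((expR 1)%:E + \sum_(n <oo) (f n w)%:E))).
  apply: ge0_le_integral => //.
  - exact: emeasurable_funD.
  move=> w _; have [n hn] := expR_powR_le_nat pgt1 qgt1 pq (y0 w).
  rewrite X4; apply: (@le_trans _ _ ((expR 1)%:E + (f n w)%:E)).
    rewrite -EFinD lee_fin; apply: (le_trans hn); rewrite lerD2l.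
    rewrite addrC expRD -mulNr ler_wpM2l ?expR_ge0//.
    apply: le_trans (expR_norm_le _ _); rewrite ler_expR.
    by rewrite mulrA mulrAC.
  rewrite leeD2l//.
  apply: le_trans (@nneseries_lim_ge _ _ xpredT 0 n.+1 _); last first.
    by move=> k _ _; rewrite lee_fin.
  rewrite big_nat_recr//= leeDr// sume_ge0// => k _.
  by rewrite lee_fin.
rewrite ge0_integralD//; last first.
- by move=> w _; apply: nneseries_ge0 => k _ _; rewrite lee_fin.
rewrite integral_cst//= probability_setT mule1 integral_nneseries//; last first.
  by move=> n w _; rewrite lee_fin.
have -> : (5 * expR 1)%:E = (expR 1)%:E + (4 * expR 1)%:E :> \bar R.
  by rewrite -EFinD; congr EFin; ring.
rewrite leeD2l//.
apply: (@le_trans _ _ (\sum_(n <oo) (4 * expR 1 / (2 ^ (n + 1))%:R)%:E)).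
  apply: lee_nneseries => // n _ _; apply: integral_ge0 => w _.
  by rewrite lee_fin.
have := @cvg_geometric_eseries_half R (4 * expR 1)%R 0.
by move/cvg_lim => ->//; rewrite expr0 divr1.
Qed.

(** * Equivalence of the two norms *)

Theorem theorem2p7 (R : realType) (p : R) (hp : (1 <= p)%R)
    (d : measure_display) (T : measurableType d) (P : probability T R) :
  exists c C : R, (0 < c)%R /\ (0 < C)%R /\
    forall X : {RV P >-> R}, Lpsi0 p X ->
      c%:E * psi_norm P p X <= tau_varphi P p X /\
      tau_varphi P p X <= C%:E * psi_norm P p X.
Proof.
have M1 : (1 <= 5 * expR 1 :> R)%R by have := @expR1_ge2 R; lra.
have e6 : (0 < expR 6 :> R)%R by exact: expR_gt0.
exists (20 * expR 1)^-1%R, (expR 6); split; first by rewrite invr_gt0; lra.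
split=> // X [_ /= X0]; split.
  apply: le_ereal_inf_tmp => _ [K /= [K0 KX] <-].
  rewrite lee_pdivrMl; last by lra.
  have -> : (20 * expR 1)%:E * K%:E = (5 * expR 1 * (4 * K))%:E.
    by rewrite -EFinM; congr EFin; ring.
  apply: psi_norm_le => //; first by rewrite mulr_gt0.
  exact: integral_expR_powR_le.
rewrite -lee_pdivrMl//; apply: le_ereal_inf_tmp => _ [K /= [K0 KX] <-].
rewrite lee_pdivrMl//; apply: ereal_inf_lbound.
exists (expR 6 * K)%R => //=; split; first by rewrite mulr_gt0.
by apply: mmt_le_expR_varphi => //; move: KX; rewrite unlock.
Qed.
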